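(* Let $\mathbb{F}$ be a field, let $\Gamma$ be a finite group acting on a finite set of variables $X$, and let $\mathcal{F}=\{f_1,\dots,f_m\}\subseteq \mathbb{F}[X]$ be a $\Gamma$-invariant system of polynomial equations. If $\mathcal{F}$ is unsatisfiable, then there is a $\Gamma$-symmetric IPS refutation of $\mathcal{F}$.
   Context: A system of polynomial equations is a finite set $\mathcal{F}\subseteq\mathbb{F}[X]$; it is unsatisfiable if the polynomials in $\mathcal{F}$ have no common zero over the algebraic closure of $\mathbb{F}$. A group $\Gamma$ acting on $X$ acts on polynomials by substitution of variables; $\mathcal{F}$ is $\Gamma$-invariant if $\{\pi(f): f\in\mathcal{F}\}=\mathcal{F}$ for every $\pi\in\Gamma$. An algebraic circuit over a variable set $Z$ and field $\mathbb{F}$ is a connected directed acyclic graph whose gates of in-degree $0$ (input gates) are labelled by elements of $Z\cup\mathbb{F}$ and whose other gates are labelled $+$ or $\times$ (arbitrary fan-in); it has a single output gate and computes a polynomial in $\mathbb{F}[Z]$ in the obvious way. If $\Gamma$ acts on $Z$ (and trivially on $\mathbb{F}$), the circuit is $\Gamma$-symmetric if for every $\pi\in\Gamma$ there is an automorphism $\sigma$ of the directed graph that preserves the labels of internal gates and satisfies $\lambda(\sigma(g))=\pi(\lambda(g))$ for every input gate $g$ with label $\lambda(g)$. IPS: let $Y=\{y_1,\dots,y_m\}$ be fresh variables; an IPS certificate for $\mathcal{F}$ is a polynomial $C(\vec x,\vec y)\in\mathbb{F}[X\uplus Y]$ with $C(\vec x,\vec 0)=0$ and $C(\vec x,f_1,\dots,f_m)=1$;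 an IPS refutation of $\mathcal{F}$ is an algebraic circuit over $X\uplus Y$ computing an IPS certificate. If $\mathcal{F}$ is $\Gamma$-invariant, $\Gamma$ acts on $Y$ by $\pi(y_i)=y_j$ where $\pi(f_i)=f_j$, and a $\Gamma$-symmetric IPS refutation is an IPS refutation that is a $\Gamma$-symmetric circuit with respect to this action on $X\uplus Y$. *)

(* Defs.v *)
From HB Require Import structures.
From mathcomp Require Import all_boot all_order all_fingroup all_algebra.
From mathcomp Require Import mpoly.

Set Implicit Arguments.
Unset Strict Implicit.
Unset Printing Implicit Defensive.

Import GRing.Theory.
Local Open Scope ring_scope.

(* F[Z] for a finite set of variables Z, through the bijection
   enum_rank : Z -> 'I_#|Z|. *)
Notation polyvar F Z := {mpoly F[#|{: Z}|]}.

Section Polynomials.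
Variable F : fieldType.

Definition pvar (Z : finType) (z : Z) : polyvar F Z := 'X_(enum_rank z).

Definition psubst (Z W : finType) (s : Z -> polyvar F W) (p : polyvar F Z) :
    polyvar F W :=
  p \mPo [tuple s (enum_val i) | i < #|Z|].

Definition peval (Z : finType) (L : fieldType) (iota : {rmorphism F -> L})
    (a : Z -> L) (p : polyvar F Z) : L :=
  (map_mpoly iota p).@[fun i => a (enum_val i)].

Lemma psubst_var (Z W : finType) (s : Z -> polyvar F W) (z : Z) :
  psubst s (pvar z) = s z.
Proof. by rewrite /psubst comp_mpolyXU -tnth_nth tnth_mktuple enum_rankK. Qed.

Lemma peval_var (Z : finType) (L : fieldType) (iota : {rmorphism F -> L})
  (a : Z -> L) (z : Z) : peval iota a (pvar z) = a z.
Proof. by rewrite /peval map_mpolyX mevalXU enum_rankK. Qed.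

End Polynomials.

Definition is_algebraic_closure (F : fieldType) (L : closedFieldType)
    (iota : {rmorphism F -> L}) : Prop :=
  forall x : L, algebraicOver iota x.

Section Circuits.
Variables (F : fieldType) (Z : finType).

Inductive gate_label : Type :=
  | LVar of Z
  | LConst of F
  | LAdd
  | LMul.

Definition input_label (l : gate_label) : bool :=
  match l with LVar _ | LConst _ => true | LAdd | LMul => false end.

(* [edge g h] means that the value of g is fed into h. The output gate is the
   only gate of out-degree 0, so every automorphism fixes it. *)
Record circuit := Circuit {
  gate : finType;
  edge : rel gate;
  label : gate -> gate_label;
  output : gate;
  circuit_acyclic : forall c : seq gate, path.cycle edge c -> c = [::];
  circuit_connected :
    forall g h : gate, connect (fun u v => edge u v || edge v u) g h;
  circuit_labels :
    forall g : gate, input_label (label g) = (#|[set h | edge h g]| == 0%N);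
  circuit_output :
    forall g : gate, (#|[set h | edge g h]| == 0%N) = (g == output)
}.

(* By acyclicity there is exactly one v satisfying these equations. *)
Definition gate_values (C : circuit) (v : gate C -> polyvar F Z) : Prop :=
  forall g : gate C,
    v g = match label g with
          | LVar z => pvar F z
          | LConst c => c%:MP
          | LAdd => \sum_(h | edge h g) v h
          | LMul => \prod_(h | edge h g) v h
          end.

Definition computes (C : circuit) (p : polyvar F Z) : Prop :=
  exists2 v : gate C -> polyvar F Z, gate_values v & v (output C) = p.

Definition label_act (s : Z -> Z) (l : gate_label) : gate_label :=
  match l with
  | LVar z => LVar (s z)
  | LConst c => LConst c
  | LAdd => LAdd
  | LMul => LMul
  end.

Definition symmetric_circuit (gT : finGroupType) (Gam : {set gT})
    (act : Z -> gT -> Z) (C : circuit) : Prop :=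
  forall a : gT, a \in Gam ->
  exists sigma : {perm gate C},
    (forall g h : gate C, edge (sigma g) (sigma h) = edge g h) /\
    (forall g : gate C, label (sigma g) = label_act (act^~ a) (label g)).

End Circuits.

Section IPS.
Variables (F : fieldType) (X : finType) (m : nat).
Variable f : 'I_m -> polyvar F X.

Definition unsatisfiable (L : closedFieldType) (iota : {rmorphism F -> L}) :
    Prop :=
  ~ exists a : X -> L, forall i : 'I_m, peval iota a (f i) = 0.

(* The variable set X + Y is the type X + 'I_m, with y_i := inr i. *)
Definition IPS_certificate (C : polyvar F (X + 'I_m)%type) : Prop :=
  psubst (fun z => match z with inl x => pvar F x | inr _ => 0 end) C = 0 /\
  psubst (fun z => match z with inl x => pvar F x | inr i => f i end) C = 1.

Definition IPS_refutation (C : circuit F (X + 'I_m)%type) : Prop :=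
  exists2 p, computes C p & IPS_certificate p.

Variables (gT : finGroupType) (Gam : {group gT}) (to : action Gam X).

Definition poly_act (p : polyvar F X) (a : gT) : polyvar F X :=
  psubst (fun x => pvar F (to x a)) p.

Definition invariant_system : Prop :=
  forall a : gT, a \in Gam ->
  forall p : polyvar F X,
    (exists i, poly_act (f i) a = p) <-> (exists i, f i = p).

(* The default value i is irrelevant for invariant systems (see eqn_actE). *)
Definition eqn_act (i : 'I_m) (a : gT) : 'I_m :=
  odflt i [pick j | f j == poly_act (f i) a].

Lemma eqn_actE (a : gT) (i : 'I_m) :
  invariant_system -> a \in Gam -> f (eqn_act i a) = poly_act (f i) a.
Proof.
move=> inv aG; rewrite /eqn_act; case: pickP => [j /eqP //|no].
have [j fj] := (inv a aG _).1 (ex_intro _ i erefl).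
by have := no j; rewrite fj eqxx.
Qed.

Definition var_act (z : X + 'I_m) (a : gT) : X + 'I_m :=
  match z with inl x => inl (to x a) | inr i => inr (eqn_act i a) end.

Definition symmetric_IPS_refutation (C : circuit F (X + 'I_m)%type) : Prop :=
  IPS_refutation C /\ symmetric_circuit Gam var_act C.

End IPS.

(* Main.v *)
(* A certificate C = \sum_i g_i y_i with \sum_i g_i f_i = 1 exists by the weak
   Nullstellensatz. Averaging it over the group would require dividing by the
   group order; instead 1 - \prod_u (1 - C^u), the product running over the
   conjugates of C, is a certificate in every characteristic, and it is computed
   by a tree in which the group permutes the factors.

   The Nullstellensatz is proved by induction on the number of variables. If I
   is a proper nonzero ideal, a substitution x_j := y_j + t^(B^j) makes some
   element of I monic in t; a zero of the contracted ideal then extends to a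
   zero of I, because by Nakayama the fibre over it is a proper ideal of K[t].
   The coefficients g_i, found over L, solve a linear system over F, hence can
   be chosen in F. *)
Require Import Defs.
From HB Require Import structures.
From mathcomp Require Import all_boot all_order all_fingroup all_algebra.
From mathcomp Require Import mpoly.
From Stdlib Require Import Classical.

Set Implicit Arguments.
Unset Strict Implicit.
Unset Printing Implicit Defensive.

Import GRing.Theory.
Local Open Scope ring_scope.

(** * Ideals as predicates, and ideals of univariate polynomials *)

Definition is_ideal (R : comNzRingType) (I : R -> Prop) : Prop :=
  [/\ I 0, forall a b, I a -> I b -> I (a + b) & forall a b, I b -> I (a * b)].

Lemma ideal_sum (R : comNzRingType) (I : R -> Prop) (T : Type) (r : seq T)
    (P : pred T) (F : T -> R) :
  is_ideal I -> (forall i, P i -> I (F i)) -> I (\sum_(i <- r | P i) F i).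
Proof. by case=> I0 ID _ IF; apply: (big_ind I). Qed.

Lemma ideal_preim (R S : comNzRingType) (h : {rmorphism R -> S})
    (I : S -> Prop) : is_ideal I -> is_ideal (fun a => I (h a)).
Proof.
case=> I0 ID IM; split=> [|a b Ia Ib|a b Ib]; first by rewrite rmorph0.
- by rewrite rmorphD; apply: ID.
- by rewrite rmorphM; apply: IM.
Qed.

(** Descent on the size: if [p] fails to divide some [q] in [J], the remainder of [q] by [p] is a
    smaller nonzero element of [J]. Classical logic enters because [J] is an arbitrary predicate. *)
Lemma ideal_poly_principal (K : fieldType) (J : {poly K} -> Prop) :
  is_ideal J -> exists2 g, J g & forall q, J q -> g %| q.
Proof.
case=> J0 JD JM.
have [[p [Jp]]|no] := classic (exists p, J p /\ p != 0); last first.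
  exists 0 => // q Jq; rewrite dvd0p; apply/negPn/negP => q0.
  by apply: no; exists q.
elim: {p}_.+1 {-2}p (ltnSn (size p)) Jp => // n IHn p szp Jp p0.
have [|no] := classic (forall q, J q -> p %| q); first by exists p.
have [q /(@imply_to_and (J q) _) [Jq /negP pq]] := not_all_ex_not _ _ no.
apply: (IHn (q %% p)) => //.
- by apply: leq_trans (ltn_modpN0 q p0) _.
- have -> : q %% p = q + - (q %/ p) * p.
    by rewrite {2}(divp_eq q p) mulNr addrC addKr.
  by apply: JD => //; apply: JM.
Qed.

(** A generator of [J] is not a nonzero constant, so it has a root; this includes the generator
    0. *)
Lemma ideal_poly_root (K : closedFieldType) (J : {poly K} -> Prop) :
  is_ideal J -> ~ J 1 -> exists a, forall p, J p -> root p a.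
Proof.
move=> idJ J1; have [_ _ JM] := idJ.
have [g Jg gP] := ideal_poly_principal idJ.
have [|a ga] := closed_rootP g _.
  apply/negP => /size_poly1P[c c0 gE]; apply: J1.
  by rewrite -polyC1 -(mulVf c0) polyCM -gE; apply: JM.
by exists a => p /gP /dvdpP[q ->]; rewrite rootM ga orbT.
Qed.

(** * Ideals containing a monic polynomial, under a map of coefficients *)

Section MonicExtension.
Variables (A : comNzRingType) (K : fieldType) (h : {rmorphism A -> K}).

(** Being monic, [g] keeps its degree under [h], so [h] maps the division of [p] by [g] to a
    division of 0, whose remainder is unique. *)
Lemma map_poly_rmodp_eq0 (p g : {poly A}) : g \is monic ->
  map_poly h p = 0 -> map_poly h (Pdiv.Ring.rmodp p g) = 0.
Proof.
move=> mg hp; set r := Pdiv.Ring.rmodp p g.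
have := congr1 (map_poly h) (Pdiv.RingMonic.rdivp_eq mg p).
rewrite hp rmorphD rmorphM /= -/r => E; rewrite (modpP E) ?mod0p //.
rewrite [X in (_ < X)%N]size_map_poly_id0 ?(monicP mg) ?rmorph1 ?oner_neq0 //.
apply: leq_ltn_trans (size_poly _ _) _.
by rewrite Pdiv.Ring.ltn_rmodp monic_neq0.
Qed.

(* Nakayama: modulo I, multiplication by 1 - f maps the span of
   1, x, ..., x^(d-1), d = deg g, into itself by a matrix M with h(M) = 0,
   while it is the identity; hence det (1 - M) lies in I. *)
Lemma ideal_image_proper (I : {poly A} -> Prop) (g : {poly A}) :
    is_ideal I -> ~ I 1 -> g \is monic -> I g ->
    (forall a : A, I a%:P -> h a = 0) ->
  forall f, I f -> map_poly h f <> 1.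
Proof.
move=> idI I1 mg Ig hI f If hf; have [I0 ID IM] := idI.
have g0 := monic_neq0 mg.
have szg : size g = (size g).-1.+1 by rewrite prednK // size_poly_gt0.
set d := (size g).-1 in szg.
(* The case [d = 0] is apart because the determinant step below reads off the row of index 0. *)
case Ed: d => [|d'].
  apply: I1; suff <- : g = 1 by [].
  have /size_poly1P[c _ gE] : size g == 1%N by rewrite szg Ed.
  by move: mg; rewrite gE monicE lead_coefC => /eqP ->.
pose r (i : 'I_d) := Pdiv.Ring.rmodp ('X^i * (1 - f)) g.
pose M := \matrix_(i < d, j < d) (r i)`_j.
have rE i : r i = \sum_(j < d) (M i j)%:P * 'X^j.
  have szr : (size (r i) <= d)%N by rewrite -ltnS -szg Pdiv.Ring.ltn_rmodp.
  have -> : r i = \poly_(j < d) (r i)`_j.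
    apply/polyP => k; rewrite coef_poly; case: ltnP => // dk.
    by rewrite nth_default // (leq_trans szr).
  rewrite poly_def.
  by apply: eq_bigr => j _; rewrite mxE mul_polyC.
have Ir (i : 'I_d) : I ('X^i - r i).
  have -> : 'X^i - r i =
      'X^i * f + Pdiv.Ring.rdivp ('X^i * (1 - f)) g * g.
    have := Pdiv.RingMonic.rdivp_eq mg ('X^i * (1 - f)); rewrite -/(r i).
    set q := Pdiv.Ring.rdivp _ _ * g => E.
    have -> : q = 'X^i * (1 - f) - r i by rewrite E addrK.
    by rewrite mulrBr mulr1 addrA addrCA subrr addr0.
  by apply: ID; apply: IM.
have hM : map_mx h M = 0.
  apply/matrixP => i j; rewrite !mxE -coef_map map_poly_rmodp_eq0 ?coef0 //.
  by rewrite rmorphM rmorphB /= hf rmorph1 subrr mulr0.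
pose N := map_mx polyC (1%:M - M).
pose v : 'cV[{poly A}]_d := \col_i 'X^i.
have INv i : I ((N *m v) i 0).
  suff -> : (N *m v) i 0 = 'X^i - r i by [].
  rewrite /N map_mxB map_mx1 mulmxBl mul1mx !mxE rE; congr (_ - _).
  by apply: eq_bigr => j _; rewrite !mxE.
(* Cramer's rule: the adjugate turns [N *m v] into [\det N] times [v], and the entry of [v] at index
   0 is ['X^0 = 1]. *)
have Idet : I (\det (1%:M - M) *: 1)%R.
  have : I ((\adj N *m (N *m v)) (cast_ord (esym Ed) ord0) 0).
    by rewrite mxE; apply: ideal_sum => // j _; apply: IM.
  rewrite mulmxA mul_adj_mx /N det_map_mx mul_scalar_mx !mxE expr0.
  by rewrite mulr1 alg_polyC.
have := hI (\det (1%:M - M)); rewrite -alg_polyC => /(_ Idet) /eqP.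
by rewrite -det_map_mx map_mxB map_mx1 hM subr0 det1 oner_eq0.
Qed.

(** The section [s] lifts any multiplier over [K] to one over [A], which gives closure under
    multiplication. *)
Lemma ideal_image (s : {rmorphism K -> A}) (I : {poly A} -> Prop) :
    cancel s h -> is_ideal I ->
  is_ideal (fun p => exists2 f, I f & map_poly h f = p).
Proof.
move=> sK [I0 ID IM]; split=> [|p q [f If <-] [g Ig <-]|p q [f If <-]].
- by exists 0; rewrite ?rmorph0.
- by exists (f + g); rewrite ?rmorphD //; apply: ID.
- exists (map_poly s p * f); first exact: IM.
  by rewrite rmorphM /= -map_poly_comp map_poly_id // => x _; apply: sK.
Qed.

End MonicExtension.

(** * Nagata's change of variables, preceded by digit and substitution lemmas *)

Lemma digits_inj (B n : nat) (m1 m2 : 'I_n -> nat) :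
    (forall i, m1 i < B)%N -> (forall i, m2 i < B)%N ->
    (\sum_(i < n) m1 i * B ^ i = \sum_(i < n) m2 i * B ^ i)%N -> m1 =1 m2.
Proof.
elim: n m1 m2 => [|n IHn] m1 m2 lt1 lt2; first by move=> _ [].
have B0 : (0 < B)%N by apply: leq_trans (lt1 ord0).
have E m : (\sum_(i < n.+1) m i * B ^ i =
    (\sum_(i < n) m (lift ord0 i) * B ^ i) * B + m ord0)%N.
  rewrite big_ord_recl expn0 muln1 addnC big_distrl /=; congr addn.
  by apply: eq_bigr => i _; rewrite -mulnA -expnSr.
rewrite !E => Em.
have e0 : m1 ord0 = m2 ord0.
  by have := congr1 (modn^~ B) Em; rewrite !modnMDl !modn_small.
move: Em; rewrite e0 => /addIn /eqP; rewrite eqn_pmul2r // => /eqP.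
move/(IHn (m1 \o lift ord0) (m2 \o lift ord0)
  (fun i => lt1 _) (fun i => lt2 _)) => e.
by move=> i; case: (unliftP ord0 i) => [j|] ->; [apply: e | apply: e0].
Qed.

Lemma rmorph_mmap n (R : nzRingType) (S T : comNzRingType)
    (c : {rmorphism S -> T}) (a : R -> S) (u : 'I_n -> S) (p : {mpoly R[n]}) :
  c (mmap a u p) = mmap (c \o a) (c \o u) p.
Proof.
rewrite /mmap rmorph_sum; apply: eq_bigr => m _.
by rewrite rmorphM rmorph_prod; congr (_ * _); apply: eq_bigr => i _;
  rewrite rmorphXn.
Qed.

Lemma eq_mmap n (R S : nzRingType) (a b : R -> S) (u v : 'I_n -> S)
    (p : {mpoly R[n]}) : a =1 b -> u =1 v -> mmap a u p = mmap b v p.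
Proof.
by move=> ab uv; apply: eq_bigr => m _; rewrite ab (mmap1_eq _ uv).
Qed.

Lemma mmap_id n (R : nzRingType) (p : {mpoly R[n]}) :
  mmap (@mpolyC n R) (fun i => 'X_i) p = p.
Proof.
rewrite {2}[p]mpolyE; apply: eq_bigr => m _.
by rewrite mmap1_id mul_mpolyC.
Qed.

Lemma seq_argmax (T : eqType) (w : T -> nat) (s : seq T) : s != [::] ->
  exists2 x, x \in s & forall y, y \in s -> (w y <= w x)%N.
Proof.
elim: s => // a [|b s] IHs _.
  by exists a; rewrite ?inE // => y; rewrite inE => /eqP ->.
have [//|x xs xP] := IHs; have [wxa|/ltnW wax] := leqP (w x) (w a).
  exists a; rewrite ?mem_head // => y; rewrite inE => /predU1P[-> //|/xP].
  by move/leq_trans; apply.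
exists x; first by rewrite inE xs orbT.
by move=> y; rewrite inE => /predU1P[->|/xP].
Qed.

Section Nagata.
Variables (K : fieldType) (n B : nat).
Hypothesis B_gt0 : (0 < B)%N.

(** Variable 0 becomes [t] and variable [j + 1] becomes [t^(B^(j+1)) + y_j]. As [B^0 = 1], the
    degree in [t] is [B^i] in both cases. *)
Definition nagata_var (i : 'I_n.+1) : {poly {mpoly K[n]}} :=
  if unlift ord0 i is Some j then 'X^(B ^ i) + ('X_j)%:P else 'X.

Local Notation nagata := (mmap (polyC \o @mpolyC n K) nagata_var).

Local Notation nagata_inv :=
  (horner_eval 'X_ord0 \o
   map_poly (mmap (@mpolyC n.+1 K)
     (fun j : 'I_n => 'X_(lift ord0 j) - 'X_ord0 ^+ (B ^ j.+1)))).

Lemma nagataK (p : {mpoly K[n.+1]}) : nagata_inv (nagata p) = p.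
Proof.
rewrite rmorph_mmap /= -[RHS]mmap_id; apply: eq_mmap => [c|i] /=.
  by rewrite /horner_eval map_polyC hornerC /= mmapC.
rewrite /horner_eval /nagata_var; case: (unliftP ord0 i) => [j|] ->.
  rewrite rmorphD rmorphXn /= map_polyX map_polyC /= mmapX mmap1U.
  by rewrite hornerD hornerXn hornerC addrC subrK.
by rewrite map_polyX hornerX.
Qed.

Lemma nagata_var_monic i :
  nagata_var i \is monic /\ size (nagata_var i) = (B ^ i).+1.
Proof.
rewrite /nagata_var; case: (unliftP ord0 i) => [j|] ->.
  have Bj : (0 < B ^ lift ord0 j)%N by rewrite expn_gt0 B_gt0.
  by rewrite monicXnaddC // size_XnaddC.
by rewrite monicX size_polyX.
Qed.

(** Degrees of monic factors add up. Exponents below [B] are thus the base-[B] digits of the degree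
    in [t]. *)
Lemma nagata_monomial_monic (m : 'X_{1..n.+1}) :
  mmap1 nagata_var m \is monic /\
  size (mmap1 nagata_var m) = (\sum_(i < n.+1) m i * B ^ i).+1.
Proof.
rewrite /mmap1; elim/big_rec2: _ => [|i p d _ [mp szp]].
  by rewrite monic1 size_poly1.
have [mu szu] := nagata_var_monic i; have muX := monic_exp (m i) mu.
have szX : size (nagata_var i ^+ m i) = (m i * B ^ i).+1.
  rewrite -[LHS]prednK ?size_poly_gt0 ?monic_neq0 // size_exp szu.
  by rewrite mulnC.
by rewrite monicMl // size_monicM ?monic_neq0 // szp szX addnS.
Qed.

(** Since [B] exceeds every exponent in [f], distinct monomials get distinct degrees in [t]; the one
    of largest weight alone gives the leading term, with its scalar coefficient. *)
Lemma nagata_lead (f : {mpoly K[n.+1]}) : f != 0 -> (msize f <= B)%N ->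
  exists2 c, c != 0 & lead_coef (nagata f) = c%:MP.
Proof.
move=> f0 fB; pose w (m : 'X_{1..n.+1}) := (\sum_(i < n.+1) m i * B ^ i)%N.
have [|ms msf msP] := @seq_argmax _ w (msupp f); first by rewrite msupp_eq0.
have cs0 : f@_ms != 0 by rewrite -mcoeff_msupp.
exists f@_ms => //; rewrite /mmap (bigD1_seq ms) //= mul_polyC.
have [mU szU] := nagata_monomial_monic ms.
have cs0' : (f@_ms)%:MP_[n] != 0 by rewrite mpolyC_eq0.
rewrite lead_coefDl; first by rewrite lead_coefZ (monicP mU) mulr1.
rewrite size_scale // szU ltnS -/(w ms) big_seq_cond.
apply: (big_ind (fun p : {poly _} => (size p <= w ms)%N)).
- by rewrite size_poly0.
- move=> p q szp szq; apply: leq_trans (size_polyD _ _) _.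
  by rewrite geq_max szp.
move=> m /andP[mf m_ms]; rewrite mul_polyC.
apply: leq_trans (size_scale_leq _ _) _.
have [_ ->] := nagata_monomial_monic m.
(* Equal weights have equal base-[B] digits, which would force [m = ms]. *)
rewrite ltn_neqAle msP // andbT; apply: contra m_ms => /eqP wE.
have lt m' : m' \in msupp f -> forall i, (m' i < B)%N.
  move=> m'f i; apply: leq_trans fB; apply: leq_ltn_trans (msize_mdeg_lt m'f).
  by rewrite mdegE (bigD1 i) //= leq_addr.
by apply/eqP/mnmP; apply: digits_inj wE; apply: lt.
Qed.

End Nagata.

(** * The weak Nullstellensatz over an algebraically closed field *)

Section Nullstellensatz.
Variable K : closedFieldType.

Lemma proper_ideal_zero n (I : {mpoly K[n]} -> Prop) :
  is_ideal I -> ~ I 1 -> exists a, forall p, I p -> p.@[a] = 0.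
Proof.
elim: n I => [|n IHn] I idI I1; have [I0 ID IM] := idI.
  exists (fun=> 0) => p Ip.
  have pE : p = (p@_0)%:MP.
    apply/mpolyP => m; rewrite mcoeffC.
    by have -> : m = 0%MM; [apply/mnmP; case | rewrite eqxx mulr1].
  rewrite pE mevalC; apply/eqP/negPn/negP => c0; apply: I1.
  by rewrite -mpolyC1 -(mulVf c0) mpolyCM -pE; apply: IM.
have [[f [If f0]]|no] := classic (exists f, I f /\ f != 0); last first.
  exists (fun=> 0) => p Ip; suff -> : p = 0 by rewrite meval0.
  by apply/eqP/negPn/negP => p0; apply: no; exists p.
pose B := msize f.
have B0 : (0 < B)%N by rewrite lt0n msize_poly_eq0.
have [c c0 lc] := nagata_lead B0 f0 (leqnn _).
(* [psi] is the inverse change of variables for this [B]; the preimage [J] of [I] is an ideal of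
   polynomials in [t] over [n] variables. *)
pose psi : {rmorphism {poly {mpoly K[n]}} -> {mpoly K[n.+1]}} :=
  horner_eval 'X_ord0 \o
   map_poly (mmap (@mpolyC n.+1 K)
     (fun j : 'I_n => 'X_(lift ord0 j) - 'X_ord0 ^+ (B ^ j.+1))).
pose phi := mmap (polyC \o @mpolyC n K) (@nagata_var K n B).
have psiK p : psi (phi p) = p by apply: nagataK.
have idJ := ideal_preim psi idI.
pose J p := I (psi p); rewrite -/J in idJ.
have J1 : ~ J 1 by rewrite /J rmorph1.
(* The elements of [J] free of [t] form the ideal to which the induction hypothesis applies. *)
have idJ0 := ideal_preim (@polyC {mpoly K[n]}) idJ.
have [a aP] := IHn _ idJ0 J1.
pose g := phi (c^-1 *: f).
have Jg : J g by rewrite /J psiK -mul_mpolyC; apply: IM.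
have mg : g \is monic.
  rewrite /g /phi mmapZ /= mul_polyC monicE lead_coefZ lc -mpolyCM mulVf //.
have image1 := ideal_image_proper idJ J1 mg Jg aP.
have sK : cancel (@mpolyC n K) (meval a) by move=> x; apply: mevalC.
have [|t tP] := ideal_poly_root (ideal_image sK idJ).
  by case=> q Jq; apply: image1.
(* The zero [(a, t)] of [J], carried back to the original coordinates. *)
exists (fun i => (map_poly (meval a) (nagata_var K B i)).[t]) => p Ip.
have /rootP <- : root (map_poly (meval a) (phi p)) t.
  have Jp : J (phi p) by rewrite /J psiK.
  exact: (tP _ (ex_intro2 _ _ (phi p) Jp erefl)).
have := rmorph_mmap (horner_eval t \o map_poly (meval a))
  (polyC \o @mpolyC n K) (@nagata_var K n B) p.
rewrite /= {1}/horner_eval => ->.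
apply: eq_mmap => x //=.
by rewrite /horner_eval map_polyC hornerC /= mevalC.
Qed.

(** If 1 were outside the ideal generated by the equations, a zero of that ideal would be a common
    zero of them. *)
Lemma weak_nullstellensatz n m (f : 'I_m -> {mpoly K[n]}) :
    ~ (exists a, forall i, (f i).@[a] = 0) ->
  exists g : 'I_m -> {mpoly K[n]}, \sum_i g i * f i = 1.
Proof.
move=> unsat; apply: NNPP => no; apply: unsat.
pose I p := exists g : 'I_m -> {mpoly K[n]}, \sum_i g i * f i = p.
have idI : is_ideal I.
  split=> [|p q [g <-] [h <-]|p q [g <-]].
  - by exists (fun=> 0); rewrite big1 // => i _; rewrite mul0r.
  - exists (fun i => g i + h i); rewrite -big_split.
    by apply: eq_bigr => i _; rewrite mulrDl.
  - exists (fun i => p * g i); rewrite big_distrr /=.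
    by apply: eq_bigr => i _; rewrite mulrA.
have [a aP] := proper_ideal_zero idI no; exists a => i; apply: aP.
exists (fun j => (j == i)%:R); rewrite (bigD1 i) //= eqxx mul1r big1 ?addr0 //.
by move=> j /negPf ->; rewrite mul0r.
Qed.

End Nullstellensatz.

(** * Descent of the coefficients to the base field *)

Lemma span1_descent (F L : fieldType) (iota : {rmorphism F -> L}) n
    (T : finType) (p : T -> {mpoly F[n]}) (c : T -> L) :
    \sum_t c t *: map_mpoly iota (p t) = 1 ->
  exists d : T -> F, \sum_t d t *: p t = 1.
Proof.
(* The successor keeps [B] positive, so that the constant monomial is always among the columns. *)
move=> c1; pose B := (\max_t msize (p t)).+1.
pose V (q : {mpoly F[n]}) : 'rV_#|{: 'X_{1..n < B}}| :=
  \row_j q@_(enum_val j : 'X_{1..n < B}).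
pose M := \matrix_(k < #|T|) V (p (enum_val k)).
(* Membership in a row space over [F] can be tested after extension to [L]. *)
have : (V 1 <= M)%MS.
  rewrite -(map_submx iota); apply/submxP.
  exists (\row_k c (enum_val k)); apply/rowP => j; rewrite !mxE.
  have := congr1 (mcoeff (enum_val j : 'X_{1..n < B})) c1.
  rewrite (reindex_onto (@enum_val T predT) enum_rank) /=; last first.
    by move=> t _; rewrite enum_rankK.
  rewrite raddf_sum /= !mcoeff1 rmorph_nat => <-.
  apply: eq_big => [k|k _]; first by rewrite enum_valK eqxx.
  by rewrite mcoeffZ mcoeff_map_mpoly !mxE.
case/submxP=> D VE; exists (fun t => D 0 (enum_rank t)).
apply/mpolyP => m; rewrite raddf_sum /=.
have [mB|mB] := ltnP (mdeg m) B.
  have /rowP/(_ (enum_rank (BMultinom mB))) := VE; rewrite !mxE enum_rankK /=.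
  move=> ->.
  rewrite (reindex_onto (@enum_val T predT) enum_rank) /=; last first.
    by move=> t _; rewrite enum_rankK.
  apply: eq_big => [k|k _]; first by rewrite enum_valK eqxx.
  by rewrite mcoeffZ !mxE enum_valK enum_rankK.
rewrite mcoeff1 big1 => [|t _].
  by case: eqP mB => // ->; rewrite mdeg0.
rewrite mcoeffZ memN_msupp_eq0 ?mulr0 // msize_mdeg_ge //.
by apply: leq_trans (ltnW mB); apply: leq_bigmax.
Qed.

(** Once the degrees of the cofactors are bounded by those of the [g i], their coefficients solve a
    finite linear system, spanned by the products ['X_[k] * f i]. *)
Lemma nullstellensatz_descent (F L : fieldType) (iota : {rmorphism F -> L}) n m
    (f : 'I_m -> {mpoly F[n]}) (g : 'I_m -> {mpoly L[n]}) :
    \sum_i g i * map_mpoly iota (f i) = 1 ->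
  exists h : 'I_m -> {mpoly F[n]}, \sum_i h i * f i = 1.
Proof.
move=> g1; pose B := \max_i msize (g i).
pose p (t : 'I_m * 'X_{1..n < B}) := 'X_[t.2] * f t.1.
have [|d d1] := @span1_descent F L iota n _ p (fun t => (g t.1)@_(t.2)).
  rewrite -g1 -(pair_bigA _ (fun i (k : 'X_{1..n < B}) =>
    (g i)@_k *: map_mpoly iota ('X_[k] * f i))) /=.
  apply: eq_bigr => i _; rewrite [in RHS](@mpolywE _ _ B (g i)) ?leq_bigmax //.
  rewrite big_distrl /=; apply: eq_bigr => k _.
  by rewrite rmorphM /= map_mpolyX scalerAl.
exists (fun i => \sum_(k : 'X_{1..n < B}) d (i, k) *: 'X_[k]).
under eq_bigr => i _ do rewrite big_distrl.
rewrite pair_bigA -d1; apply: eq_bigr => -[i k] _ /=.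
by rewrite scalerAl.
Qed.

(** * Substitutions, and polynomials as sums of products of inputs *)

Section Substitution.
Variable F : fieldType.

HB.instance Definition _ (Z W : finType) (s : Z -> polyvar F W) :=
  GRing.RMorphism.copy (psubst s)
    (comp_mpoly [tuple s (enum_val i) | i < #|Z|]).

Lemma psubstE (Z W : finType) (s : Z -> polyvar F W) p :
  psubst s p = mmap (@mpolyC _ F) (fun i => s (enum_val i)) p.
Proof. by apply: eq_mmap => // i; rewrite tnth_mktuple. Qed.

Lemma psubstC (Z W : finType) (s : Z -> polyvar F W) c :
  psubst s c%:MP = c%:MP.
Proof. exact: comp_mpolyC. Qed.

Lemma eq_psubst (Z W : finType) (s t : Z -> polyvar F W) :
  s =1 t -> psubst s =1 psubst t.
Proof. by move=> st p; rewrite !psubstE; apply: eq_mmap => // i. Qed.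

Lemma psubst_comp (Z W V : finType) (t : W -> polyvar F V)
    (s : Z -> polyvar F W) p :
  psubst t (psubst s p) = psubst (fun z => psubst t (s z)) p.
Proof.
rewrite !psubstE rmorph_mmap.
by apply: eq_mmap => [c|i] /=; rewrite ?mmapC // psubstE.
Qed.

Definition input_value (Z : finType) (l : gate_label F Z) : polyvar F Z :=
  match l with LVar z => pvar F z | LConst c => c%:MP | _ => 0 end.

Lemma psubst_input_value (Z : finType) (s : Z -> Z) (l : gate_label F Z) :
  psubst (fun z => pvar F (s z)) (input_value l) = input_value (label_act s l).
Proof. by case: l => [z|c||] /=; rewrite ?psubst_var ?psubstC ?rmorph0. Qed.

(** The monomial expansion made rectangular: all products share the index set [J], spare slots
    holding the constant 1. [k0] and [j0] show that no sum or product is empty, as inner gates must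
    have inputs. *)
Lemma sum_of_products (Z : finType) (q : polyvar F Z) :
  exists (K J : finType) (k0 : K) (j0 : J) (l : K -> J -> gate_label F Z),
    (forall k j, input_label (l k j)) /\
    q = \sum_k \prod_j input_value (l k j).
Proof.
pose b := (msize q).+1; pose n := #|{: Z}|.
have b0 : (mdeg (0%MM : 'X_{1..n}) < b)%N by rewrite mdeg0.
(* Slot [inl tt] holds the coefficient; the slots [inr (i, e)] with [e < k i] hold the [k i] copies
   of variable [i]. *)
pose l (k : 'X_{1..n < b}) (j : unit + 'I_n * 'I_b) :=
  match j with
  | inl _ => LConst Z q@_k
  | inr (i, e) => if (e < k i)%N then LVar F (enum_val i) else LConst Z 1
  end.
exists 'X_{1..n < b}, (unit + 'I_n * 'I_b)%type, (BMultinom b0), (inl tt), l.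
split=> [k [//|[i e] /=]|]; first by case: ifP.
rewrite [LHS](@mpolywE _ _ b) //; apply: eq_bigr => k _.
rewrite big_sumType /= (bigD1 tt) //= big_pred0 => [|[] //].
rewrite mulr1 mul_mpolyC; congr (_ *: _).
pose x (i : 'I_n) (e : 'I_b) : polyvar F Z := if (e < k i)%N then 'X_i else 1.
rewrite mpolyXE_id (eq_bigr (fun t => x t.1 t.2)) => [|[i e] _]; last first.
  by rewrite /x /=; case: ifP => _ /=; rewrite /pvar ?enum_valK.
rewrite -(pair_bigA _ x) /=; apply: eq_bigr => i _.
rewrite /x -big_mkcond -(big_ord_widen b (fun=> 'X_i)).
  by rewrite prodr_const card_ord.
rewrite ltnW // (leq_ltn_trans _ (bmdeg k)) //.
by rewrite mdegE (bigD1 i) //= leq_addr.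
Qed.

End Substitution.

(** * A symmetric circuit for one minus the product of all conjugates *)

Section NormCircuit.
Variables (F : fieldType) (Z : finType) (gT : finGroupType) (Gam : {group gT}).
Variable act : Z -> gT -> Z.
Variables (K J : finType) (k0 : K) (j0 : J) (l : K -> J -> gate_label F Z).
Hypothesis l_input : forall k j, input_label (l k j).

(** A tree for [1 + (-1) * \prod_u \sum_k \prod_j] of inputs. Each group element [u] owns a separate
    subtree, inputs included, so that the group can permute whole subtrees. *)
Inductive norm_gate :=
  | NOut | NOne | NNeg | NNegOne
  | NSum of subg_of Gam
  | NTerm of subg_of Gam & K
  | NInput of subg_of Gam & K & J.

Definition norm_gate_encode (g : norm_gate) :
    bool * bool + (subg_of Gam + (subg_of Gam * K + subg_of Gam * K * J)) :=
  match g with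
  | NOut => inl (true, true) | NOne => inl (true, false)
  | NNeg => inl (false, true) | NNegOne => inl (false, false)
  | NSum u => inr (inl u)
  | NTerm u k => inr (inr (inl (u, k)))
  | NInput u k j => inr (inr (inr (u, k, j)))
  end.

Definition norm_gate_decode
    (x : bool * bool +
         (subg_of Gam + (subg_of Gam * K + subg_of Gam * K * J))) :=
  match x with
  | inl (true, true) => NOut | inl (true, false) => NOne
  | inl (false, true) => NNeg | inl (false, false) => NNegOne
  | inr (inl u) => NSum u
  | inr (inr (inl (u, k))) => NTerm u k
  | inr (inr (inr (u, k, j))) => NInput u k j
  end.

Lemma norm_gate_encodeK : cancel norm_gate_encode norm_gate_decode.
Proof. by case. Qed.

HB.instance Definition _ := Finite.copy norm_gate (can_type norm_gate_encodeK).

(** With edges given by a parent function, a permutation of the gates is a graph automorphism as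
    soon as it commutes with that function. *)
Definition norm_parent (g : norm_gate) : option norm_gate :=
  match g with
  | NOut => None
  | NOne | NNeg => Some NOut
  | NNegOne | NSum _ => Some NNeg
  | NTerm u _ => Some (NSum u)
  | NInput u k _ => Some (NTerm u k)
  end.

Definition norm_edge : rel norm_gate := fun g h => norm_parent g == Some h.

Definition norm_depth (g : norm_gate) : nat :=
  match g with
  | NOut => 0 | NOne | NNeg => 1 | NNegOne | NSum _ => 2
  | NTerm _ _ => 3 | NInput _ _ _ => 4
  end.

Definition norm_label (g : norm_gate) : gate_label F Z :=
  match g with
  | NOut | NSum _ => LAdd F Z
  | NNeg | NTerm _ _ => LMul F Z
  | NOne => LConst Z 1
  | NNegOne => LConst Z (-1)
  | NInput u k j => label_act (act^~ (val u)) (l k j)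
  end.

Lemma norm_edge_depth g h : norm_edge g h -> (norm_depth h < norm_depth g)%N.
Proof. by move/eqP; case: g => [||||u|u k|u k j] //= [<-]. Qed.

Lemma norm_acyclic (c : seq norm_gate) : path.cycle norm_edge c -> c = [::].
Proof.
case: c => //= x p; pose r := [rel g h | (norm_depth h < norm_depth g)%N].
move/(sub_path (e' := r) norm_edge_depth).
move/order_path_min => /(_ (fun _ _ _ h1 h2 => ltn_trans h2 h1)).
by rewrite all_rcons /= ltnn.
Qed.

Lemma norm_connected g h :
  connect (fun u v => norm_edge u v || norm_edge v u) g h.
Proof.
set e := fun _ _ => _.
have to_out x : connect e x NOut.
  have [n] := ubnP (norm_depth x); elim: n x => // n IHn x /ltnSE xn.
  case E: (norm_parent x) => [y|]; last by case: x E {xn}.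
  have xy : norm_edge x y by apply/eqP.
  apply: connect_trans (connect1 _) (IHn y _); first by rewrite /e xy.
  exact: leq_trans (norm_edge_depth xy) xn.
apply: connect_trans (to_out g) _; rewrite sym_connect_sym //.
by move=> x y; rewrite /e orbC.
Qed.

(** Every inner gate has a child: a constant gate, a copy of the tree, or the child indexed by [k0]
    or [j0]. *)
Lemma norm_labels g :
  input_label (norm_label g) = (#|[set h | norm_edge h g]| == 0%N).
Proof.
rewrite cards_eq0; apply/idP/eqP => [|E].
  move=> lg; apply/setP => h; rewrite !inE; apply/negbTE/negP => /eqP.
  by case: h => [||||u|u k|u k j] //= [E]; rewrite -E in lg.
have no h : norm_edge h g = false by have := in_set0 h; rewrite -E inE.
case: g E no => //= [||u|u k|u k j] _ no.
- by have := no NOne; rewrite /norm_edge eqxx.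
- by have := no NNegOne; rewrite /norm_edge eqxx.
- by have := no (NTerm u k0); rewrite /norm_edge eqxx.
- by have := no (NInput u k j0); rewrite /norm_edge eqxx.
- by have := l_input k j; case: (l k j).
Qed.

Lemma norm_output g : (#|[set h | norm_edge g h]| == 0%N) = (g == NOut).
Proof.
rewrite cards_eq0; apply/eqP/eqP => [E|->]; last first.
  by apply/setP => h; rewrite !inE.
case Eg: (norm_parent g) => [h|]; last by case: g Eg {E}.
by have := in_set0 h; rewrite -E inE /norm_edge Eg eqxx.
Qed.

Definition norm_circuit : circuit F Z :=
  Circuit norm_acyclic norm_connected norm_labels norm_output.

Let term (u : subg_of Gam) k :=
  \prod_j input_value (label_act (act^~ (val u)) (l k j)).

Lemma norm_circuit_computes :
  computes norm_circuit (1 - \prod_u \sum_k term u k).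
Proof.
pose v (g : norm_gate) : polyvar F Z :=
  match g with
  | NOut => 1 - \prod_u \sum_k term u k
  | NOne => 1
  | NNeg => - \prod_u \sum_k term u k
  | NNegOne => -1
  | NSum u => \sum_k term u k
  | NTerm u k => term u k
  | NInput u k j => input_value (label_act (act^~ (val u)) (l k j))
  end.
exists v => // -[||||u|u k|u k j] /=.
- rewrite (bigD1 NOne) //= (bigD1 NNeg) //=.
  by rewrite [X in _ = _ + (_ + X)]big1 ?addr0 // => -[].
- by rewrite mpolyC1.
- rewrite (bigD1 NNegOne) //= mulN1r; congr (- _).
  (* The default [1%g] is harmless: with [NNegOne] split off, only gates [NSum u] feed [NNeg]. *)
  rewrite (reindex_onto NSum (fun g => if g is NSum u then u else 1%g)) /=.
    by apply: eq_bigl => u; rewrite eqxx.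
  by case=> [||||u|u k|u k j] // /andP[].
- by rewrite mpolyCN mpolyC1.
- rewrite (reindex_onto (NTerm u) (fun g => if g is NTerm _ k then k else k0)).
    by apply: eq_bigl => k; rewrite /= /norm_edge !eqxx.
  by case=> [||||u'|u' k|u' k j] // /eqP[] ->.
- rewrite (reindex_onto (NInput u k)
    (fun g => if g is NInput _ _ j then j else j0)).
    by apply: eq_bigl => j; rewrite /= /norm_edge !eqxx.
  by case=> [||||u'|u' k'|u' k' j] // /eqP[] -> ->.
- by have := l_input k j; case: (l k j).
Qed.

Hypothesis actM : forall z,
  {in Gam &, forall a b, act z (a * b)%g = act (act z a) b}.

(** The automorphism for [a] is right translation [u -> u * a] of the copies. The inputs of copy [u]
    carry labels moved by [u], so [actM] makes the translation act on labels as [a]. *)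
Lemma norm_circuit_symmetric : symmetric_circuit Gam act norm_circuit.
Proof.
move=> a aG.
pose shift (b : subg_of Gam) (g : norm_gate) : norm_gate :=
  match g with
  | NSum u => NSum (u * b)
  | NTerm u k => NTerm (u * b) k
  | NInput u k j => NInput (u * b) k j
  | g => g
  end.
have shiftK b : cancel (shift b) (shift b^-1%g).
  by case=> [||||u|u k|u k j] //=; rewrite mulgK.
pose s := shift (subg Gam a); have s_inj : injective s := can_inj (shiftK _).
exists (perm s_inj); split=> [g h|g].
  rewrite !permE /= /norm_edge.
  have -> : norm_parent (s g) = omap s (norm_parent g) by case: g.
  case: (norm_parent g) => //= x.
  by rewrite -[LHS]/(s x == s h) (inj_eq s_inj).
rewrite !permE; case: g => //= u k j.
have uG : val u \in Gam by apply: subgP.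
case: (l k j) => //= z; rewrite -actM //.
by congr (LVar _ (act z _)); rewrite /= subgK.
Qed.

End NormCircuit.

(** * The certificate and its symmetric refutation *)

Section Refutation.
Variables (F : fieldType) (gT : finGroupType) (Gam : {group gT}) (X : finType).
Variables (to : action Gam X) (m : nat) (f : 'I_m -> polyvar F X).

Lemma poly_actM (p : polyvar F X) : {in Gam &, forall a b,
  poly_act to p (a * b)%g = poly_act to (poly_act to p a) b}.
Proof.
move=> a b aG bG; rewrite /poly_act psubst_comp; apply: eq_psubst => x.
by rewrite psubst_var actMin.
Qed.

(** For the variables [y_i], injectivity of [f] reduces the law to that of [poly_act]. It is
    restricted to [Gam], where invariance determines [eqn_act]. *)
Lemma var_actM : injective f -> invariant_system f to ->
  forall z, {in Gam &, forall a b,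
    var_act f to z (a * b)%g = var_act f to (var_act f to z a) b}.
Proof.
move=> f_inj inv [x|i] a b aG bG /=; first by rewrite actMin.
congr inr; apply: f_inj.
by rewrite !eqn_actE ?groupM // poly_actM.
Qed.

Definition linear_certificate (g : 'I_m -> polyvar F X) :
    polyvar F (X + 'I_m)%type :=
  \sum_i psubst (fun x => pvar F (inl x : X + 'I_m)%type) (g i)
         * pvar F (inr i : X + 'I_m)%type.

Lemma psubst_linear_certificate (W : finType)
    (s : (X + 'I_m)%type -> polyvar F W) g :
  psubst s (linear_certificate g) =
  \sum_i psubst (fun x => s (inl x)) (g i) * s (inr i).
Proof.
rewrite rmorph_sum; apply: eq_bigr => i _; rewrite rmorphM /= psubst_var.
by rewrite psubst_comp (eq_psubst (fun x => psubst_var s (inl x))).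
Qed.

Lemma psubst_var_act (W : finType) (s : (X + 'I_m)%type -> polyvar F W) a p :
  psubst s (psubst (fun z => pvar F (var_act f to z a)) p) =
  psubst (fun z => s (var_act f to z a)) p.
Proof.
by rewrite psubst_comp (eq_psubst (fun z => psubst_var s (var_act f to z a))).
Qed.

(** Substituting by [a] in [\sum_i g i * f i = 1] fixes the right side and only renumbers the
    equations. *)
Lemma certificate_conj_at_eqns g a :
    invariant_system f to -> a \in Gam -> \sum_i g i * f i = 1 ->
  \sum_i psubst (fun x => pvar F (to x a)) (g i) * f (eqn_act f to i a) = 1.
Proof.
move=> inv aG gf.
rewrite -[RHS](rmorph1 (psubst (fun x => pvar F (to x a)))) -gf rmorph_sum.
by apply: eq_bigr => i _; rewrite rmorphM eqn_actE.
Qed.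

(* At y = 0 every conjugate of the certificate is 0; at y = f it is 1. *)
Lemma norm_certificate (g : 'I_m -> polyvar F X) :
    invariant_system f to -> \sum_i g i * f i = 1 ->
  IPS_certificate f (1 - \prod_(u : subg_of Gam)
    psubst (fun z => pvar F (var_act f to z (val u)))
      (1 - linear_certificate g)).
Proof.
move=> inv gf; split; rewrite rmorphB rmorph1 rmorph_prod /=.
  rewrite big1 ?subrr // => u _.
  rewrite psubst_var_act rmorphB rmorph1 /= psubst_linear_certificate.
  by rewrite big1 ?subr0 // => i _; rewrite mulr0.
rewrite (eq_bigr (fun=> 0)) => [|u _]; last first.
  rewrite psubst_var_act rmorphB rmorph1 /= psubst_linear_certificate /=.
  by rewrite certificate_conj_at_eqns ?subrr //; apply: subgP.
(* The product of zeros vanishes because it is not empty: the group contains 1. *)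
rewrite prodr_const expr0n (_ : (_ == 0)%N = false) ?subr0 //.
by apply/negbTE; rewrite -lt0n; apply/card_gt0P; exists 1%g.
Qed.

End Refutation.

Theorem theorem4p2 (F : fieldType)
  (L : closedFieldType) (iota : {rmorphism F -> L})
  (hL : is_algebraic_closure iota)
  (gT : finGroupType) (Gam : {group gT}) (X : finType) (to : action Gam X)
  (m : nat) (f : 'I_m -> polyvar F X)
  (hf : injective f)
  (hinv : invariant_system f to)
  (hunsat : unsatisfiable f iota) :
  exists C : circuit F (X + 'I_m)%type, symmetric_IPS_refutation f to C.
Proof.
have [|g0 g01] := @weak_nullstellensatz L _ _ (fun i => map_mpoly iota (f i)).
  case=> a aP; apply: hunsat; exists (fun x => a (enum_rank x)) => i.
  by rewrite -(aP i) /peval; apply: meval_eq => j; rewrite enum_valK.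
have [g gf] := nullstellensatz_descent g01.
have cert := norm_certificate hinv gf; set q := 1 - linear_certificate g in cert.
have [K [J [k0 [j0 [l [l_input qE]]]]]] := sum_of_products q.
exists (norm_circuit Gam (var_act f to) k0 j0 l_input); split; last first.
  exact: norm_circuit_symmetric (var_actM hf hinv).
eexists; first exact: norm_circuit_computes.
(* Moving the input labels by [u] computes the conjugate of [q] by [u]. *)
suff -> : \prod_(u : subg_of Gam) \sum_k \prod_j
    input_value (label_act (var_act f to ^~ (val u)) (l k j)) =
  \prod_(u : subg_of Gam) psubst (fun z => pvar F (var_act f to z (val u))) q.
  exact: cert.
apply: eq_bigr => u _; rewrite qE rmorph_sum; apply: eq_bigr => k _.
by rewrite rmorph_prod; apply: eq_bigr => j _; rewrite /= psubst_input_value.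
Qed.
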